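(* For all real $x\ge0$, $$\sqrt{2\pi}\left(\frac{x+\frac12}{e}\right)^{x+\frac12}e^{-\frac{1}{24x+12}}\le x\widehat{!}\le\sqrt{2\pi}\left(\frac{x+\frac12}{e}\right)^{x+\frac12}e^{\frac{1}{12x+12-6\exp(1/12)}}$$ and $$\sqrt{2e}\left(\frac{x+\frac12}{e}\right)^{x+\frac12}\le x\widehat{!}\le e\left(\frac{x+\frac12}{e}\right)^{x+\frac12}$$ hold.
   Context: For real $x\ge0$, let $\lfloor x\rfloor$ be its floor and $\{x\}:=x-\lfloor x\rfloor\in[0,1)$ its fractional part. The piecewise logarithmically interpolated factorial is $x\widehat{!} := \left(\lfloor x\rfloor!\right)^{1-\{x\}}\left((\lfloor x\rfloor+1)!\right)^{\{x\}}$. *)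

(* Defs.v *)
From Stdlib Require Import Reals Factorial.
Open Scope R_scope.

(* Meant for [0 <= x]: there the integer floor [Int_part x] is nonnegative, so
   [Z.to_nat] loses nothing.  [Rpower a y] is [exp (y * ln a)], the usual power
   because the bases are positive. *)
Definition plfact (x : R) : R :=
  let n := Z.to_nat (Int_part x) in
  Rpower (INR (fact n)) (1 - frac_part x) * Rpower (INR (fact (S n))) (frac_part x).

(* Main.v *)
Require Import Defs.
From Stdlib Require Import Reals Factorial ZArith Lra Lia.
From Coquelicot Require Import Coquelicot.
Open Scope R_scope.

(** Put y = x + 1/2 and n = floor x.  Everything is a statement about the
    logarithmic error R(y) = ln (x^!) - y ln y + y, where x^! is the
    interpolated factorial, because x^! = exp (R y) * (y / e) ^ y.

    On the segment n + 1/2 <= y <= n + 3/2 the term ln (x^!) is affine with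
    slope ln (n + 1), so R' (y) = ln (n + 1) - ln y: R is concave, is smallest
    at an end of the segment and largest at its midpoint y = n + 1.  Hence two
    sequences control it:
    - the end values [half_rem n], the error of n! against (y / e) ^ y with
      y = n + 1/2;
    - the midpoint values [stirling_rem (n + 1)], the classical remainder
      ln N! - (N + 1/2) ln N + N of Stirling's formula at N = n + 1.

    The first sequence increases from (ln 2 + 1) / 2 and the second decreases
    from 1; with concavity these two facts are the bounds by sqrt (2 e) and e.
    The refined monotonicity ([half_rem_step], [stirling_rem_step]), that
    half_rem n + 1 / (24 n + 12) decreases and stirling_rem N - 1 / (12 N)
    increases, together with the common limit ln (2 PI) / 2, gives sharp
    bounds at the ends and at the midpoints.

    The limit comes from the Wallis integrals W n.  The number
    (n + 1) W n W (n + 1) = PI / 2 does not depend on n, which pins W (2 m)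
    between PI / (2 (2 m + 1)) and PI / (4 m) after squaring; on the other
    hand, W (2 m) is a central binomial coefficient, whose logarithm involves
    2 stirling_rem m - stirling_rem (2 m).

    It remains to pass to the whole segment.  For the lower bound,
    R y + 1 / (24 y) is still concave, so its values at the ends suffice
    ([interp_rem_lower_asymp]).  For the upper bound, write y = N + s.  When
    s <= 0 the bound at the midpoint is enough; when s > 0 the error falls by at
    least s^2 / (2 N) - s^3 / (6 N^2), and this has to beat the fall of the
    right-hand side.  Since exp (1/12) >= 1 + 1/12, the exponent
    1 / (12 x + 12 - 6 exp (1/12)) is at least 1 / (12 y - 1/2), and with the
    latter in its place the comparison is a polynomial inequality
    ([peak_polynomial]). *)

(** * Elementary tools *)

Lemma exp_le_exp (a b : R) : a <= b -> exp a <= exp b.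
Proof.
  intros [H | ->]; [left; apply exp_increasing, H | apply Rle_refl].
Qed.

Lemma ln_le_sub1 (z : R) : 0 < z -> ln z <= z - 1.
Proof.
  intros Hz. pose proof (exp_ineq1_le (ln z)) as H.
  rewrite exp_ln in H by exact Hz. lra.
Qed.

Lemma ln_ge_1_sub_inv (z : R) : 0 < z -> 1 - / z <= ln z.
Proof.
  intros Hz. pose proof (ln_le_sub1 (/ z) (Rinv_0_lt_compat _ Hz)) as H.
  rewrite ln_Rinv in H by exact Hz. lra.
Qed.

Lemma le_of_derive_nonneg (f f' : R -> R) (a b : R) :
  a <= b ->
  (forall t, a <= t <= b -> is_derive f t (f' t)) ->
  (forall t, a <= t <= b -> 0 <= f' t) ->
  f a <= f b.
Proof.
  intros [Hab | <-] Hd Hp; [ | apply Rle_refl].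
  destruct (MVT_cor2 f f' a b Hab) as [c [Heq Hc]].
  - intros t Ht. apply is_derive_Reals, Hd, Ht.
  - assert (0 <= f' c) by (apply Hp; lra). nra.
Qed.

(** A concave function has no interior minimum: where the derivative at [y] is
    nonnegative, the function grows from [a] to [y]; otherwise it falls from
    [y] to [b]. *)
Lemma ge_endpoint_of_derive_antitone (f f' : R -> R) (a b y l : R) :
  a <= y <= b ->
  (forall t, a <= t <= b -> is_derive f t (f' t)) ->
  (forall s t, a <= s <= t -> t <= b -> f' t <= f' s) ->
  l <= f a -> l <= f b -> l <= f y.
Proof.
  intros Hy Hd Hanti Ha Hb.
  destruct (Rle_dec 0 (f' y)) as [H | H].
  - apply Rle_trans with (1 := Ha).
    apply le_of_derive_nonneg with f'; [lra | intros; apply Hd; lra | ].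
    intros t Ht. apply Rle_trans with (1 := H). apply Hanti; lra.
  - apply Rle_trans with (1 := Hb).
    apply Ropp_le_cancel.
    apply (le_of_derive_nonneg (fun t => - f t) (fun t => - f' t)); [lra | | ].
    + intros t Ht. apply (is_derive_opp f). apply Hd; lra.
    + intros t Ht. assert (f' t <= f' y) by (apply Hanti; lra). lra.
Qed.

(** Stands in for letting m tend to infinity, so that no convergence of the
    remainder sequences has to be discussed. *)
Lemma le_of_le_add_inv (a b c : R) (n0 : nat) :
  0 < c ->
  (forall m, (n0 <= m)%nat -> (1 <= m)%nat -> a <= b + c / INR m) -> a <= b.
Proof.
  intros Hc H. apply Rnot_lt_le. intros Hlt.
  destruct (INR_unbounded (c / (a - b))) as [k Hk].
  set (m := Nat.max (S k) n0).
  assert (Hm : INR k <= INR m) by (apply le_INR; lia).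
  assert (H1 : 0 < INR m) by (apply lt_0_INR; lia).
  specialize (H m ltac:(lia) ltac:(lia)).
  assert (Hbad : c / (a - b) < INR m) by lra.
  apply (Rmult_lt_compat_r (a - b)) in Hbad; [ | lra].
  replace (c / (a - b) * (a - b)) with c in Hbad by (field; lra).
  apply (Rmult_le_compat_r (INR m)) in H; [ | lra].
  replace ((b + c / INR m) * INR m) with (b * INR m + c) in H by (field; lra).
  nra.
Qed.

(** * Estimates for the logarithm *)

Lemma ln_ratio_lower (w : R) : 0 <= w < 1 -> 2 * w <= ln (1 + w) - ln (1 - w).
Proof.
  intros Hw.
  pose proof (le_of_derive_nonneg
    (fun t => ln (1 + t) - ln (1 - t) - 2 * t)
    (fun t => 2 * t ^ 2 / (1 - t ^ 2)) 0 w) as H.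
  cbv beta in H. replace (1 + 0) with 1 in H by ring. rewrite Rminus_0_r, ln_1 in H.
  assert (0 - 0 - 2 * 0 <= ln (1 + w) - ln (1 - w) - 2 * w); [apply H | lra]; [lra | | ].
  - intros t Ht. auto_derive; [lra | field; split; [nra | lra]].
  - intros t Ht. apply Rdiv_le_0_compat; nra.
Qed.

(** The tail of the series 2 (w + w^3/3 + w^5/5 + ...) is dominated by the
    geometric series with ratio w^2 and first term 2 w^3 / 3.  With
    w = 1 / (2 N + 1) this makes the correction telescope in
    [stirling_rem_step]. *)
Lemma ln_ratio_upper (w : R) :
  0 <= w < 1 -> ln (1 + w) - ln (1 - w) <= 2 * w + 2 * w ^ 3 / (3 * (1 - w ^ 2)).
Proof.
  intros Hw.
  pose proof (le_of_derive_nonneg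
    (fun t => 2 * t + 2 * t ^ 3 / (3 * (1 - t ^ 2)) - (ln (1 + t) - ln (1 - t)))
    (fun t => 4 * t ^ 4 / (3 * (1 - t ^ 2) ^ 2)) 0 w) as H.
  cbv beta in H. replace (1 + 0) with 1 in H by ring. rewrite Rminus_0_r, ln_1 in H.
  replace (2 * 0 + 2 * 0 ^ 3 / (3 * (1 - 0 ^ 2)) - (0 - 0)) with 0 in H by field.
  assert (0 <= 2 * w + 2 * w ^ 3 / (3 * (1 - w ^ 2)) - (ln (1 + w) - ln (1 - w)));
    [apply H | lra]; [lra | | ].
  - intros t Ht. assert (0 < 1 - t ^ 2) by nra.
    auto_derive; [repeat split; nra | field; repeat split; nra].
  - intros t Ht. assert (0 < 1 - t ^ 2) by nra.
    apply Rdiv_le_0_compat; [nra | apply Rmult_lt_0_compat; [lra | nra]].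
Qed.

Lemma ln_1_sub_sqr (t : R) : 0 <= t < 1 -> ln (1 + t) + ln (1 - t) = ln (1 - t ^ 2).
Proof.
  intros Ht. rewrite <- ln_mult by lra. f_equal. ring.
Qed.

(** The derivative of the left-hand side is 2 + ln (1 - w^2). *)
Lemma xlnx_diff_upper (w : R) :
  0 <= w < 1 -> (1 + w) * ln (1 + w) - (1 - w) * ln (1 - w) <= 2 * w.
Proof.
  intros Hw.
  pose proof (le_of_derive_nonneg
    (fun t => 2 * t - ((1 + t) * ln (1 + t) - (1 - t) * ln (1 - t)))
    (fun t => - ln (1 - t ^ 2)) 0 w) as H.
  cbv beta in H. replace (1 + 0) with 1 in H by ring. rewrite Rminus_0_r, ln_1 in H.
  assert (2 * 0 - (1 * 0 - 1 * 0)
    <= 2 * w - ((1 + w) * ln (1 + w) - (1 - w) * ln (1 - w))); [apply H | lra]; [lra | | ].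
  - intros t Ht. rewrite <- ln_1_sub_sqr by lra.
    auto_derive; [lra | unfold Rminus; field; lra].
  - intros t Ht. pose proof (ln_le_sub1 (1 - t ^ 2) ltac:(nra)). nra.
Qed.

(** The correction is chosen so that, for w = 1 / (2 N), N times it is exactly
    the fall of 1 / (24 y) between y = N - 1/2 and y = N + 1/2.  Its derivative
    is at least w^2 / (1 - w^2), which already dominates - ln (1 - w^2). *)
Lemma xlnx_diff_lower (w : R) :
  0 <= w < 1 ->
  2 * w - w ^ 3 / (3 * (1 - w ^ 2)) <= (1 + w) * ln (1 + w) - (1 - w) * ln (1 - w).
Proof.
  intros Hw.
  pose proof (le_of_derive_nonneg
    (fun t => (1 + t) * ln (1 + t) - (1 - t) * ln (1 - t)
              - (2 * t - t ^ 3 / (3 * (1 - t ^ 2))))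
    (fun t => ln (1 - t ^ 2) - (1 - / (1 - t ^ 2))
              + 2 * t ^ 4 / (3 * (1 - t ^ 2) ^ 2)) 0 w) as H.
  cbv beta in H. replace (1 + 0) with 1 in H by ring. rewrite Rminus_0_r, ln_1 in H.
  replace (1 * 0 - 1 * 0 - (2 * 0 - 0 ^ 3 / (3 * (1 - 0 ^ 2)))) with 0 in H by field.
  assert (0 <= (1 + w) * ln (1 + w) - (1 - w) * ln (1 - w)
              - (2 * w - w ^ 3 / (3 * (1 - w ^ 2)))); [apply H | lra]; [lra | | ].
  - intros t Ht. assert (0 < 1 - t ^ 2) by nra. rewrite <- ln_1_sub_sqr by lra.
    auto_derive; [repeat split; nra | unfold Rminus; field; repeat split; nra].
  - intros t Ht. assert (Hp : 0 < 1 - t ^ 2) by nra.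
    pose proof (ln_ge_1_sub_inv _ Hp).
    assert (0 <= 2 * t ^ 4 / (3 * (1 - t ^ 2) ^ 2)); [ | lra].
    apply Rdiv_le_0_compat; [nra | apply Rmult_lt_0_compat; [lra | nra]].
Qed.

Lemma xlnx_excess_nonneg (z : R) : -1 < z -> 0 <= (1 + z) * ln (1 + z) - z.
Proof.
  intros Hz. pose proof (ln_ge_1_sub_inv (1 + z) ltac:(lra)) as H.
  apply (Rmult_le_compat_l (1 + z)) in H; [ | lra].
  replace ((1 + z) * (1 - / (1 + z))) with z in H by (field; lra). lra.
Qed.

Lemma ln_1_add_lower (z : R) : 0 <= z -> z - z ^ 2 / 2 <= ln (1 + z).
Proof.
  intros Hz.
  pose proof (le_of_derive_nonneg
    (fun t => ln (1 + t) - (t - t ^ 2 / 2)) (fun t => t ^ 2 / (1 + t)) 0 z Hz) as H.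
  cbv beta in H. replace (1 + 0) with 1 in H by ring. rewrite ln_1 in H.
  assert (0 - (0 - 0 ^ 2 / 2) <= ln (1 + z) - (z - z ^ 2 / 2)); [apply H | lra].
  - intros t Ht. auto_derive; [lra | field; lra].
  - intros t Ht. apply Rdiv_le_0_compat; nra.
Qed.

Lemma xlnx_excess_lower (z : R) :
  0 <= z -> z ^ 2 / 2 - z ^ 3 / 6 <= (1 + z) * ln (1 + z) - z.
Proof.
  intros Hz.
  pose proof (le_of_derive_nonneg
    (fun t => (1 + t) * ln (1 + t) - t - (t ^ 2 / 2 - t ^ 3 / 6))
    (fun t => ln (1 + t) - (t - t ^ 2 / 2)) 0 z Hz) as H.
  cbv beta in H. replace (1 + 0) with 1 in H by ring. rewrite ln_1 in H.
  assert (1 * 0 - 0 - (0 ^ 2 / 2 - 0 ^ 3 / 6)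
    <= (1 + z) * ln (1 + z) - z - (z ^ 2 / 2 - z ^ 3 / 6)); [apply H | lra].
  - intros t Ht. auto_derive; [lra | field; lra].
  - intros t Ht. pose proof (ln_1_add_lower t ltac:(lra)). lra.
Qed.

(** * Wallis integrals *)

Definition wallis (n : nat) : R := RInt (fun t => sin t ^ n) 0 (PI / 2).

Lemma wallis_is_RInt (n : nat) : is_RInt (fun t => sin t ^ n) 0 (PI / 2) (wallis n).
Proof.
  apply (RInt_correct (fun t => sin t ^ n)).
  apply (ex_RInt_continuous (fun t => sin t ^ n)). intros t _.
  apply (ex_derive_continuous (fun t => sin t ^ n)). auto_derive. exact I.
Qed.

Lemma wallis_0 : wallis 0 = PI / 2.
Proof.
  unfold wallis. simpl. rewrite RInt_const. unfold scal; simpl; unfold mult; simpl. lra.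
Qed.

Lemma wallis_1 : wallis 1 = 1.
Proof.
  apply is_RInt_unique. replace 1 with (minus (- cos (PI / 2)) (- cos 0)).
  - apply (is_RInt_derive (fun t => - cos t)).
    + intros t _. auto_derive; [exact I | ]. simpl. ring.
    + intros t _. apply (@ex_derive_continuous R_AbsRing R_NormedModule). auto_derive. exact I.
  - rewrite cos_PI2, cos_0. unfold minus, plus, opp; simpl. ring.
Qed.

(** Integrating the derivative of - cos t * sin t ^ (n + 1), which vanishes at
    both ends of the interval. *)
Lemma wallis_rec (n : nat) : (INR n + 2) * wallis (S (S n)) = (INR n + 1) * wallis n.
Proof.
  pose proof (is_RInt_scal _ _ _ (INR n + 2) _ (wallis_is_RInt (S (S n)))) as H2.
  pose proof (is_RInt_scal _ _ _ (INR n + 1) _ (wallis_is_RInt n)) as H0.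
  pose proof (is_RInt_minus _ _ _ _ _ _ H2 H0) as H. clear H0 H2.
  assert (Hd : is_RInt (fun t => (INR n + 2) * sin t ^ S (S n) - (INR n + 1) * sin t ^ n)
     0 (PI / 2) (- cos (PI / 2) * sin (PI / 2) ^ S n - - cos 0 * sin 0 ^ S n)).
  { apply (is_RInt_derive (fun t => - cos t * sin t ^ S n)).
    - intros t _. auto_derive; [exact I | ].
      simpl. change (match n with O => 1 | S _ => INR n + 1 end) with (INR (S n)).
      rewrite S_INR.
      assert (E : cos t * cos t = 1 - sin t * sin t)
        by (pose proof (sin2_cos2 t) as E; unfold Rsqr in E; lra).
      ring [E].
    - intros t _. apply (@ex_derive_continuous R_AbsRing R_NormedModule). auto_derive. exact I. }
  pose proof (eq_trans (eq_sym (is_RInt_unique _ _ _ _ H)) (is_RInt_unique _ _ _ _ Hd)) as U.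
  revert U. rewrite cos_PI2, sin_0.
  unfold minus, plus, opp, scal; simpl; unfold mult; simpl. lra.
Qed.

Lemma wallis_nonneg (n : nat) : 0 <= wallis n.
Proof.
  apply RInt_ge_0.
  - pose proof PI_RGT_0. lra.
  - eexists. apply wallis_is_RInt.
  - intros t Ht. apply pow_le. apply sin_ge_0; lra.
Qed.

Lemma wallis_antitone (n : nat) : wallis (S n) <= wallis n.
Proof.
  apply RInt_le.
  - pose proof PI_RGT_0. lra.
  - eexists. apply wallis_is_RInt.
  - eexists. apply wallis_is_RInt.
  - intros t Ht. simpl. pose proof (pow_le (sin t) n ltac:(apply sin_ge_0; lra)).
    pose proof (SIN_bound t). nra.
Qed.

(** The recurrence says precisely that this quantity is invariant under
    n -> n + 1. *)
Lemma wallis_product (n : nat) : (INR n + 1) * (wallis n * wallis (S n)) = PI / 2.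
Proof.
  induction n as [ | n IH].
  - rewrite wallis_0, wallis_1. simpl. ring.
  - rewrite <- IH, S_INR. pose proof (wallis_rec n) as H.
    replace ((INR n + 1 + 1) * (wallis (S n) * wallis (S (S n))))
      with (wallis (S n) * ((INR n + 2) * wallis (S (S n)))) by ring.
    rewrite H. ring.
Qed.

(** That is, W (2 m) = PI / 2 * binomial (2 m) m / 4 ^ m. *)
Lemma wallis_even (m : nat) :
  wallis (2 * m) * (4 ^ m * (INR (fact m) * INR (fact m))) = PI / 2 * INR (fact (2 * m)).
Proof.
  induction m as [ | m IH].
  - simpl (2 * 0)%nat. rewrite wallis_0. simpl. ring.
  - replace (2 * S m)%nat with (S (S (2 * m))) by lia.
    pose proof (wallis_rec (2 * m)) as H.
    assert (E : INR (2 * m) = 2 * INR m) by (rewrite mult_INR; reflexivity).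
    rewrite E in H. pose proof (pos_INR m).
    rewrite !fact_simpl, !mult_INR, !S_INR, E. simpl (4 ^ S m).
    assert (W : wallis (S (S (2 * m))) = (2 * INR m + 1) / (2 * INR m + 2) * wallis (2 * m)).
    { apply (Rmult_eq_reg_l (2 * INR m + 2)); [ | lra]. rewrite H. field. lra. }
    rewrite W.
    transitivity ((2 * INR m + 1) / (2 * INR m + 2) * 4 * (INR m + 1) ^ 2
         * (wallis (2 * m) * (4 ^ m * (INR (fact m) * INR (fact m))))); [ring | ].
    rewrite IH. field. lra.
Qed.

Lemma wallis_even_pos (m : nat) : 0 < wallis (2 * m).
Proof.
  pose proof (wallis_even m) as E.
  destruct (wallis_nonneg (2 * m)) as [H | H]; [exact H | exfalso].
  rewrite <- H, Rmult_0_l in E.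
  pose proof PI_RGT_0. pose proof (INR_fact_lt_0 (2 * m)).
  assert (0 < PI / 2 * INR (fact (2 * m))) by (apply Rmult_lt_0_compat; lra). lra.
Qed.

(** * The remainder in Stirling's formula *)

Definition lfact (n : nat) : R := ln (INR (fact n)).

Lemma lfact_S (n : nat) : lfact (S n) = lfact n + ln (INR n + 1).
Proof.
  unfold lfact. rewrite fact_simpl, mult_INR, S_INR, ln_mult; [ring | | ].
  - pose proof (pos_INR n). lra.
  - apply INR_fact_lt_0.
Qed.

Definition stirling_rem (n : nat) : R := lfact n - (INR n + 1 / 2) * ln (INR n) + INR n.

(** The difference of the remainders is (n + 1/2) ln ((n + 1) / n) - 1, and
    (n + 1) / n = (1 + w) / (1 - w) for w = 1 / (2 n + 1). *)
Lemma stirling_rem_step (n : nat) : (1 <= n)%nat ->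
  0 <= stirling_rem n - stirling_rem (S n) <= 1 / (12 * INR n) - 1 / (12 * INR (S n)).
Proof.
  intros Hn. assert (H1 : 1 <= INR n) by (apply (le_INR 1), Hn).
  unfold stirling_rem. rewrite lfact_S, S_INR. set (a := INR n) in *.
  set (w := 1 / (2 * a + 1)).
  assert (Hw : 0 <= w < 1).
  { unfold w. split; [apply Rdiv_le_0_compat; lra | ].
    apply Rlt_div_l; lra. }
  pose proof (ln_ratio_lower w Hw) as HL. pose proof (ln_ratio_upper w Hw) as HU.
  assert (E : ln (1 + w) - ln (1 - w) = ln (a + 1) - ln a).
  { rewrite <- !ln_div by lra. f_equal. unfold w. field. lra. }
  rewrite E in HL, HU.
  apply (Rmult_le_compat_l (a + 1 / 2)) in HL; [ | lra].
  apply (Rmult_le_compat_l (a + 1 / 2)) in HU; [ | lra].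
  replace ((a + 1 / 2) * (2 * w)) with 1 in HL by (unfold w; field; lra).
  replace ((a + 1 / 2) * (2 * w + 2 * w ^ 3 / (3 * (1 - w ^ 2))))
    with (1 + (1 / (12 * a) - 1 / (12 * (a + 1)))) in HU
    by (unfold w; field; repeat split; nra).
  lra.
Qed.

Lemma stirling_rem_mono (m n : nat) : (1 <= m <= n)%nat ->
  0 <= stirling_rem m - stirling_rem n <= 1 / (12 * INR m) - 1 / (12 * INR n).
Proof.
  intros [Hm Hmn]. induction Hmn as [ | n Hmn IH]; [lra | ].
  pose proof (stirling_rem_step n ltac:(lia)). lra.
Qed.

Definition stirling_const : R := ln (2 * PI) / 2.

(** By [wallis_even], ln (W (2 m)) equals ln PI - ln (2 m) / 2 minus the middle
    expression, and W (2 m) squared lies between PI / (2 (2 m + 1)) and PI / (4 m) by [wallis_product] and the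
    monotonicity of W. *)
Lemma stirling_rem_wallis (m : nat) : (1 <= m)%nat ->
  stirling_const <= 2 * stirling_rem m - stirling_rem (2 * m)
    <= stirling_const + 1 / (4 * INR m).
Proof.
  intros Hm. assert (H1 : 1 <= INR m) by (apply (le_INR 1), Hm).
  assert (E2 : INR (2 * m) = 2 * INR m) by (rewrite mult_INR; reflexivity).
  pose proof PI_RGT_0 as Hpi.
  pose proof (wallis_even_pos m) as Wpos.
  assert (Hlog : ln (wallis (2 * m)) =
    stirling_rem (2 * m) - 2 * stirling_rem m + (ln PI - (ln 2 + ln (INR m)) / 2)).
  { pose proof (f_equal ln (wallis_even m)) as E.
    pose proof (INR_fact_lt_0 m). pose proof (INR_fact_lt_0 (2 * m)).
    pose proof (pow_lt 4 m ltac:(lra)).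
    rewrite !ln_mult in E by (repeat apply Rmult_lt_0_compat; lra).
    rewrite (ln_mult (PI / 2)), ln_div, ln_pow in E by lra.
    replace 4 with (2 * 2) in E by lra. rewrite ln_mult in E by lra.
    unfold stirling_rem, lfact. rewrite E2, (ln_mult 2) by lra. lra. }
  assert (Hlow : ln PI - ln 2 <= 2 * ln (wallis (2 * m)) + ln (2 * INR m + 1)).
  { rewrite <- ln_div by lra. rewrite <- (wallis_product (2 * m)), E2.
    replace (2 * ln (wallis (2 * m))) with (ln (wallis (2 * m)) + ln (wallis (2 * m))) by ring.
    rewrite <- !ln_mult by nra.
    assert (0 < (2 * INR m + 1) * (wallis (2 * m) * wallis (S (2 * m)))).
    { rewrite <- E2, wallis_product. lra. }
    pose proof (wallis_antitone (2 * m)).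
    apply ln_le; [assumption | ].
    rewrite (Rmult_comm _ (2 * INR m + 1)).
    apply Rmult_le_compat_l; [lra | ]. apply Rmult_le_compat_l; lra. }
  assert (Hupp : 2 * ln (wallis (2 * m)) + (ln 2 + ln (INR m)) <= ln PI - ln 2).
  { rewrite <- ln_div by lra.
    replace (2 * ln (wallis (2 * m))) with (ln (wallis (2 * m)) + ln (wallis (2 * m))) by ring.
    rewrite <- !ln_mult by nra.
    apply ln_le; [repeat apply Rmult_lt_0_compat; lra | ].
    pose proof (wallis_product (2 * m - 1)) as E.
    pose proof (wallis_antitone (2 * m - 1)) as A.
    replace (S (2 * m - 1)) with (2 * m)%nat in * by lia.
    rewrite minus_INR, E2 in E by lia. simpl (INR 1) in E.
    rewrite <- E. replace (2 * INR m - 1 + 1) with (2 * INR m) by ring.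
    rewrite (Rmult_comm _ (2 * INR m)).
    apply Rmult_le_compat_l; [lra | ]. apply Rmult_le_compat_r; lra. }
  assert (Hgap : ln (2 * INR m + 1) - (ln 2 + ln (INR m)) <= 1 / (2 * INR m)).
  { rewrite <- ln_mult, <- ln_div by lra.
    eapply Rle_trans; [apply ln_le_sub1, Rdiv_lt_0_compat; lra | ].
    apply Req_le. field. lra. }
  assert (1 / (4 * INR m) = 1 / (2 * INR m) / 2) by (field; lra).
  unfold stirling_const. rewrite ln_mult by lra. lra.
Qed.

(** Both stirling_rem m and stirling_rem (2 m) differ from
    2 stirling_rem m - stirling_rem (2 m) by O(1/m), so monotonicity transfers
    the Wallis estimate from large m to n. *)
Lemma stirling_rem_bounds (n : nat) : (1 <= n)%nat ->
  stirling_const <= stirling_rem n <= stirling_const + 1 / (12 * INR n).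
Proof.
  intros Hn. split.
  - apply (le_of_le_add_inv _ _ (1 / 24) n); [lra | ]. intros m Hnm Hm.
    pose proof (stirling_rem_wallis m Hm). pose proof (stirling_rem_mono n m ltac:(lia)).
    pose proof (stirling_rem_mono m (2 * m) ltac:(lia)) as M.
    assert (1 <= INR m) by (apply (le_INR 1), Hm).
    rewrite mult_INR in M. simpl (INR 2) in M.
    replace (1 / (12 * INR m) - 1 / (12 * ((1 + 1) * INR m))) with (1 / 24 / INR m) in M
      by (field; lra).
    lra.
  - apply (le_of_le_add_inv _ _ (1 / 4) n); [lra | ]. intros m Hnm Hm.
    pose proof (stirling_rem_wallis m Hm). pose proof (stirling_rem_mono n m ltac:(lia)).
    pose proof (stirling_rem_mono m (2 * m) ltac:(lia)) as M.
    assert (1 <= INR m) by (apply (le_INR 1), Hm).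
    assert (0 < 1 / (12 * INR m)) by (apply Rdiv_lt_0_compat; lra).
    replace (1 / 4 / INR m) with (1 / (4 * INR m)) by (field; lra).
    lra.
Qed.

(** * The error at half-integers *)

Definition half_rem (n : nat) : R :=
  lfact n - (INR n + 1 / 2) * ln (INR n + 1 / 2) + (INR n + 1 / 2).

Lemma half_rem_0 : half_rem 0 = (ln 2 + 1) / 2.
Proof.
  unfold half_rem, lfact. simpl. rewrite ln_1.
  replace (0 + 1 / 2) with (/ 2) by lra. rewrite ln_Rinv by lra. lra.
Qed.

(** With N = n + 1 the difference is ln N minus the integral of ln over
    [N - 1/2, N + 1/2]; it is nonnegative because ln is concave, and small
    because the midpoint rule is accurate. *)
Lemma half_rem_step (n : nat) :
  0 <= half_rem (S n) - half_rem n <= 1 / (24 * INR n + 12) - 1 / (24 * INR (S n) + 12).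
Proof.
  pose proof (pos_INR n) as H0.
  unfold half_rem. rewrite lfact_S, S_INR. set (a := INR n) in *.
  set (w := 1 / (2 * (a + 1))).
  assert (Hw : 0 <= w < 1).
  { unfold w. split; [apply Rdiv_le_0_compat; lra | ].
    apply Rlt_div_l; lra. }
  pose proof (xlnx_diff_lower w Hw) as HL. pose proof (xlnx_diff_upper w Hw) as HU.
  assert (E1 : ln (a + 1 + 1 / 2) = ln (a + 1) + ln (1 + w)).
  { rewrite <- ln_mult by lra. f_equal. unfold w. field. lra. }
  assert (E2 : ln (a + 1 / 2) = ln (a + 1) + ln (1 - w)).
  { rewrite <- ln_mult by lra. f_equal. unfold w. field. lra. }
  rewrite E1, E2.
  apply (Rmult_le_compat_l (a + 1)) in HL; [ | lra].
  apply (Rmult_le_compat_l (a + 1)) in HU; [ | lra].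
  replace ((a + 1) * (2 * w)) with 1 in HU by (unfold w; field; lra).
  replace ((a + 1) * (2 * w - w ^ 3 / (3 * (1 - w ^ 2))))
    with (1 - (1 / (24 * a + 12) - 1 / (24 * (a + 1) + 12))) in HL
    by (unfold w; field; repeat split; nra).
  replace ((a + 1) * ((1 + w) * ln (1 + w) - (1 - w) * ln (1 - w)))
    with ((a + 1 + 1 / 2) * ln (1 + w) - (a + 1 / 2) * ln (1 - w)) in *
    by (unfold w; field; lra).
  lra.
Qed.

Lemma half_rem_mono (m n : nat) : (m <= n)%nat ->
  0 <= half_rem n - half_rem m <= 1 / (24 * INR m + 12) - 1 / (24 * INR n + 12).
Proof.
  intros Hmn. induction Hmn as [ | n Hmn IH]; [lra | ].
  pose proof (half_rem_step n). lra.
Qed.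

Lemma half_rem_vs_stirling_rem (m : nat) : (1 <= m)%nat ->
  stirling_rem m - 1 / (4 * INR m) <= half_rem m.
Proof.
  intros Hm. assert (H1 : 1 <= INR m) by (apply (le_INR 1), Hm).
  unfold stirling_rem, half_rem.
  pose proof (ln_le_sub1 ((INR m + 1 / 2) / INR m) ltac:(apply Rdiv_lt_0_compat; lra)) as H.
  rewrite ln_div in H by lra.
  apply (Rmult_le_compat_l (INR m + 1 / 2)) in H; [ | lra].
  replace ((INR m + 1 / 2) * ((INR m + 1 / 2) / INR m - 1)) with (1 / 2 + 1 / (4 * INR m))
    in H by (field; lra).
  lra.
Qed.

(** half_rem n + 1 / (24 n + 12) decreases, and for large n it is within
    O(1/n) of the Stirling remainder, hence of its limit. *)
Lemma half_rem_lower (n : nat) : stirling_const - 1 / (24 * INR n + 12) <= half_rem n.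
Proof.
  apply (le_of_le_add_inv _ _ (1 / 4) n); [lra | ]. intros m Hnm Hm.
  pose proof (half_rem_mono n m Hnm). pose proof (half_rem_vs_stirling_rem m Hm).
  pose proof (stirling_rem_bounds m Hm).
  assert (1 <= INR m) by (apply (le_INR 1), Hm).
  assert (0 < 1 / (24 * INR m + 12)) by (apply Rdiv_lt_0_compat; lra).
  replace (1 / 4 / INR m) with (1 / (4 * INR m)) by (field; lra).
  lra.
Qed.

(** * The error of the interpolated factorial *)

(** The logarithmic error at y = x + 1/2 for n <= x <= n + 1; the endpoint
    x = n + 1 is included, where the formula agrees with that of the next
    segment. *)
Definition interp_rem (n : nat) (y : R) : R :=
  lfact n + (y - (INR n + 1 / 2)) * ln (INR n + 1) - y * ln y + y.

Lemma interp_rem_left (n : nat) : interp_rem n (INR n + 1 / 2) = half_rem n.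
Proof. unfold interp_rem, half_rem. ring. Qed.

Lemma interp_rem_right (n : nat) : interp_rem n (INR n + 3 / 2) = half_rem (S n).
Proof.
  unfold interp_rem, half_rem. rewrite lfact_S, S_INR.
  replace (INR n + 1 + 1 / 2) with (INR n + 3 / 2) by lra. lra.
Qed.

Lemma is_derive_interp_rem (n : nat) (t : R) : 0 < t ->
  is_derive (interp_rem n) t (ln (INR n + 1) - ln t).
Proof.
  intros Ht. unfold interp_rem. auto_derive; [lra | field; lra].
Qed.

Lemma interp_rem_lower_asymp (n : nat) (y : R) : INR n + 1 / 2 <= y <= INR n + 3 / 2 ->
  stirling_const - 1 / (24 * y) <= interp_rem n y.
Proof.
  intros Hy. pose proof (pos_INR n) as H0.
  assert (stirling_const <= interp_rem n y + 1 / (24 * y)); [ | lra].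
  apply (ge_endpoint_of_derive_antitone (fun t => interp_rem n t + 1 / (24 * t))
    (fun t => ln (INR n + 1) - ln t - 1 / (24 * t ^ 2))
    (INR n + 1 / 2) (INR n + 3 / 2)); [exact Hy | | | | ].
  - intros t Ht.
    replace (ln (INR n + 1) - ln t - 1 / (24 * t ^ 2))
      with (plus (ln (INR n + 1) - ln t) (- 1 / (24 * t ^ 2)))
      by (unfold plus; simpl; field; nra).
    apply (is_derive_plus (interp_rem n) (fun t => 1 / (24 * t))).
    + apply is_derive_interp_rem. lra.
    + auto_derive; [nra | field; nra].
  (* ln t - ln s >= (t - s) / t outweighs the increase of - 1 / (24 t^2),
     because s >= 1/2. *)
  - intros s t Hs Ht.
    pose proof (ln_ge_1_sub_inv (t / s) ltac:(apply Rdiv_lt_0_compat; lra)) as HL.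
    rewrite ln_div in HL by lra.
    assert (1 / (24 * s ^ 2) - 1 / (24 * t ^ 2) <= 1 - / (t / s)); [ | lra].
    assert (E : 1 - / (t / s) - (1 / (24 * s ^ 2) - 1 / (24 * t ^ 2)) =
      (t - s) * (24 * s ^ 2 * t - (t + s)) / (24 * s ^ 2 * t ^ 2)) by (field; lra).
    assert (0 <= (t - s) * (24 * s ^ 2 * t - (t + s)) / (24 * s ^ 2 * t ^ 2)); [ | lra].
    assert (Hs2 : 1 / 4 <= s ^ 2) by nra. assert (Ht2 : 0 < t ^ 2) by nra.
    apply Rdiv_le_0_compat; [ | apply Rmult_lt_0_compat; lra].
    apply Rmult_le_pos; [lra | ]. nra.
  - rewrite interp_rem_left. pose proof (half_rem_lower n).
    replace (24 * (INR n + 1 / 2)) with (24 * INR n + 12) by lra. lra.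
  - rewrite interp_rem_right. pose proof (half_rem_lower (S n)) as H. rewrite S_INR in H.
    replace (24 * (INR n + 3 / 2)) with (24 * (INR n + 1) + 12) by lra. lra.
Qed.

Lemma interp_rem_lower_const (n : nat) (y : R) : INR n + 1 / 2 <= y <= INR n + 3 / 2 ->
  (ln 2 + 1) / 2 <= interp_rem n y.
Proof.
  intros Hy. pose proof (pos_INR n) as H0. rewrite <- half_rem_0.
  apply (ge_endpoint_of_derive_antitone (interp_rem n) (fun t => ln (INR n + 1) - ln t)
    (INR n + 1 / 2) (INR n + 3 / 2)); [exact Hy | | | | ].
  - intros t Ht. apply is_derive_interp_rem. lra.
  - intros s t Hs Ht. pose proof (ln_le s t ltac:(lra) ltac:(lra)). lra.
  - rewrite interp_rem_left. pose proof (half_rem_mono 0 n ltac:(lia)). lra.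
  - rewrite interp_rem_right. pose proof (half_rem_mono 0 (S n) ltac:(lia)). lra.
Qed.

(** Centring the segment at its midpoint N = n + 1, y = N (1 + z), splits the
    error into its maximum and the integral of ln (1 + u) for u from 0 to z,
    scaled by N. *)
Lemma interp_rem_peak (n : nat) (z : R) : -1 < z ->
  interp_rem n ((INR n + 1) * (1 + z)) =
  stirling_rem (S n) - (INR n + 1) * ((1 + z) * ln (1 + z) - z).
Proof.
  intros Hz. pose proof (pos_INR n).
  unfold interp_rem, stirling_rem. rewrite lfact_S, S_INR, (ln_mult (INR n + 1)) by lra.
  field.
Qed.

Lemma interp_rem_upper_const (n : nat) (y : R) : 0 < y -> interp_rem n y <= 1.
Proof.
  intros Hy. pose proof (pos_INR n).
  set (z := y / (INR n + 1) - 1).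
  assert (Hz : -1 < z) by (unfold z; pose proof (Rdiv_lt_0_compat y (INR n + 1)); lra).
  replace y with ((INR n + 1) * (1 + z)) by (unfold z; field; lra).
  rewrite interp_rem_peak by exact Hz.
  pose proof (xlnx_excess_nonneg z Hz) as X.
  pose proof (stirling_rem_mono 1 (S n) ltac:(lia)) as M.
  assert (E : stirling_rem 1 = 1) by (unfold stirling_rem, lfact; simpl; rewrite ln_1; ring).
  nra.
Qed.

(** Bounds the fall of 1 / (12 y - 1/2) below 1 / (12 N), at y = N + s, by the
    fall of the error.  The worst case is N = 1, where the difference of the
    two sides has a nearly double zero near s = 0.081. *)
Lemma peak_polynomial (N s : R) : 1 <= N -> 0 <= s <= 1 / 2 ->
  (12 * s - 1 / 2) / (12 * N * (12 * N + 12 * s - 1 / 2)) <= s ^ 2 / (2 * N) - s ^ 3 / (6 * N ^ 2).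
Proof.
  intros HN Hs.
  assert (E : s ^ 2 / (2 * N) - s ^ 3 / (6 * N ^ 2)
     - (12 * s - 1 / 2) / (12 * N * (12 * N + 12 * s - 1 / 2)) =
     ((6 * s ^ 2 * N - 2 * s ^ 3) * (12 * N + 12 * s - 1 / 2) - N * (12 * s - 1 / 2))
       / (12 * N ^ 2 * (12 * N + 12 * s - 1 / 2))) by (field; nra).
  assert (0 <= ((6 * s ^ 2 * N - 2 * s ^ 3) * (12 * N + 12 * s - 1 / 2) - N * (12 * s - 1 / 2))
       / (12 * N ^ 2 * (12 * N + 12 * s - 1 / 2))); [ | lra].
  apply Rdiv_le_0_compat; [ | apply Rmult_lt_0_compat; nra].
  assert (P : 0 <= (6 * s ^ 2 - 2 * s ^ 3) * (23 / 2 + 12 * s) - (12 * s - 1 / 2)).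
  (* [T1] bounds s^3 below by a quadratic touching it near the minimum, [T2]
     absorbs the quartic term into the cubic one; what remains is a quadratic with slightly negative discriminant,
     centred near 98/1200. *)
  { assert (T1 : 0 <= s * (s - 97 / 1200) ^ 2) by (apply Rmult_le_pos; [lra | apply pow2_ge_0]).
    assert (T2 : 0 <= s ^ 3 * (1 / 2 - s)) by (apply Rmult_le_pos; [apply pow_le; lra | lra]).
    pose proof (pow2_ge_0 (s - 98 / 1200)). nra. }
  assert (Q : 0 <= 6 * s ^ 2 - 2 * s ^ 3) by nra.
  assert (C : 0 <= 2 * s ^ 3) by (pose proof (pow_le s 3); lra).
  apply (Rmult_le_compat_l N) in P; [ | lra].
  assert (N * ((6 * s ^ 2 - 2 * s ^ 3) * (23 / 2 + 12 * s))
          <= (6 * s ^ 2 * N - 2 * s ^ 3) * (12 * N + 12 * s - 1 / 2)); [ | nra].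
  rewrite <- Rmult_assoc. apply Rmult_le_compat; nra.
Qed.

Lemma interp_rem_upper_asymp (n : nat) (y : R) : INR n + 1 / 2 <= y <= INR n + 3 / 2 ->
  interp_rem n y <= stirling_const + 1 / (12 * y - 1 / 2).
Proof.
  intros Hy. pose proof (pos_INR n) as H0.
  set (N := INR n + 1) in *. set (s := y - N).
  assert (HN : 1 <= N) by (unfold N; lra).
  assert (Hs : - (1 / 2) <= s <= 1 / 2) by (unfold s, N; lra).
  assert (Hz : -1 < s / N) by (apply Rlt_div_r; lra).
  replace y with (N * (1 + s / N)) at 1 by (unfold s; field; lra).
  unfold N at 1. rewrite interp_rem_peak by exact Hz. fold N.
  replace y with (N + s) by (unfold s; ring).
  pose proof (stirling_rem_bounds (S n) ltac:(lia)) as B. rewrite S_INR in B. fold N in B.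
  destruct (Rle_dec s 0) as [Hs0 | Hs0].
  - pose proof (xlnx_excess_nonneg _ Hz).
    assert (1 / (12 * N) <= 1 / (12 * (N + s) - 1 / 2)); [ | nra].
    apply Rmult_le_compat_l; [lra | ]. apply Rinv_le_contravar; lra.
  - pose proof (xlnx_excess_lower (s / N) ltac:(apply Rdiv_le_0_compat; lra)) as X.
    apply (Rmult_le_compat_l N) in X; [ | lra].
    replace (N * ((s / N) ^ 2 / 2 - (s / N) ^ 3 / 6))
      with (s ^ 2 / (2 * N) - s ^ 3 / (6 * N ^ 2)) in X by (field; lra).
    pose proof (peak_polynomial N s HN ltac:(lra)) as Q.
    replace ((12 * s - 1 / 2) / (12 * N * (12 * N + 12 * s - 1 / 2)))
      with (1 / (12 * N) - 1 / (12 * (N + s) - 1 / 2)) in Q by (field; lra).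
    lra.
Qed.

(** * Back to the factorial *)

Lemma plfact_eq (n : nat) (t : R) : 0 <= t < 1 ->
  plfact (INR n + t) =
  exp (interp_rem n (INR n + t + 1 / 2))
    * Rpower ((INR n + t + 1 / 2) / exp 1) (INR n + t + 1 / 2).
Proof.
  intros Ht. pose proof (pos_INR n).
  assert (Hip : Int_part (INR n + t) = Z.of_nat n).
  { symmetry. apply Int_part_spec. rewrite <- INR_IZR_INZ. lra. }
  unfold plfact, frac_part. rewrite Hip, Nat2Z.id, <- INR_IZR_INZ.
  unfold Rpower. rewrite <- !exp_plus. f_equal.
  fold (lfact n) (lfact (S n)). rewrite lfact_S.
  rewrite ln_div, ln_exp by (lra || apply exp_pos).
  unfold interp_rem. field.
Qed.

(** The lower bound is what makes [interp_rem_upper_asymp] applicable; the upper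
    one keeps the denominator 12 x + 12 - 6 exp (1/12) positive. *)
Lemma exp_twelfth_bounds : 13 / 12 <= exp (1 / 12) <= 12 / 11.
Proof.
  split; [pose proof (exp_ineq1_le (1 / 12)); lra | ].
  pose proof (exp_ineq1_le (- (1 / 12))) as H. rewrite exp_Ropp in H.
  pose proof (exp_pos (1 / 12)) as P.
  apply (Rmult_le_compat_r (exp (1 / 12))) in H; [ | lra].
  rewrite Rinv_l in H by lra. lra.
Qed.

Lemma sqrt_exp_half_ln (a : R) : 0 < a -> sqrt a = exp (ln a / 2).
Proof.
  intros Ha. rewrite <- (exp_ln a Ha) at 1.
  replace (ln a) with (ln a / 2 + ln a / 2) at 1 by field.
  rewrite exp_plus. apply sqrt_square. left. apply exp_pos.
Qed.

Theorem corollary35 :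
  forall x : R, 0 <= x ->
    (sqrt (2 * PI) * Rpower ((x + 1 / 2) / exp 1) (x + 1 / 2)
       * exp (- (1 / (24 * x + 12))) <= plfact x
     /\ plfact x <=
        sqrt (2 * PI) * Rpower ((x + 1 / 2) / exp 1) (x + 1 / 2)
          * exp (1 / (12 * x + 12 - 6 * exp (1 / 12))))
    /\
    (sqrt (2 * exp 1) * Rpower ((x + 1 / 2) / exp 1) (x + 1 / 2) <= plfact x
     /\ plfact x <= exp 1 * Rpower ((x + 1 / 2) / exp 1) (x + 1 / 2)).
Proof.
  intros x Hx.
  destruct (nfloor_ex x Hx) as [n Hn].
  assert (Hxn : x = INR n + (x - INR n)) by ring.
  pose proof (plfact_eq n (x - INR n) ltac:(lra)) as E. rewrite <- Hxn in E.
  set (P := Rpower ((x + 1 / 2) / exp 1) (x + 1 / 2)) in *.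
  assert (HP : 0 < P) by apply exp_pos.
  pose proof PI_RGT_0. pose proof (exp_pos 1).
  assert (Hy : INR n + 1 / 2 <= x + 1 / 2 <= INR n + 3 / 2) by lra.
  rewrite E, !sqrt_exp_half_ln by lra. fold stirling_const.
  rewrite ln_mult, ln_exp by lra.
  rewrite !(Rmult_comm (exp stirling_const) P), !Rmult_assoc, <- !exp_plus, !(Rmult_comm P).
  repeat split; (apply Rmult_le_compat_r; [lra | ]); apply exp_le_exp.
  - pose proof (interp_rem_lower_asymp n _ Hy) as H1.
    replace (24 * (x + 1 / 2)) with (24 * x + 12) in H1 by lra. lra.
  - pose proof (interp_rem_upper_asymp n _ Hy) as H1.
    pose proof exp_twelfth_bounds.
    assert (1 / (12 * (x + 1 / 2) - 1 / 2) <= 1 / (12 * x + 12 - 6 * exp (1 / 12))); [ | lra].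
    apply Rmult_le_compat_l; [lra | ]. apply Rinv_le_contravar; lra.
  - apply interp_rem_lower_const, Hy.
  - apply interp_rem_upper_const. lra.
Qed.
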